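(* Let $q\ge1$ be an integer, let $(G_k)_{k\ge0}$ be defined by $G_0=\dots=G_{q-2}=0$, $G_{q-1}=1$, $G_{k+q}=G_{k+q-1}+G_k$ ($k\ge0$), and let $A=(a_k)_{k\ge0}$ with $a_k=G_{k+2q-2}$. Then for all $n\ge0$: $$G_{n+q}-1=\sum_{k=0}^{n}G_k,$$ $$G_{n+q-1}=\sum_{k=0}^{\lfloor n/q\rfloor}\binom{n-k(q-1)}{k},$$ $$S_A(G_{n+q-1})=\sum_{k=0}^{\lfloor n/q\rfloor}k\binom{n-k(q-1)}{k}.$$
   Context: For $q=1$, $G_k=2^k$. The sequence $A$ is strictly increasing with $a_0=1$. For such a sequence, the greedy algorithm represents each $m\ge1$ as $m=\sum_{i\ge0}d_i a_i$ with nonnegative integer digits $d_i$: if $a_i\le m<a_{i+1}$ it selects $a_i$ and repeats on $m-a_i$ until $0$ is reached. The sum-of-digits function is $s_A(m)=\sum_{i\ge0}d_i$ (with $s_A(0)=0$), and the cumulative sum-of-digits function is $S_A(m)=\sum_{j=0}^{m-1}s_A(j)$ (so $S_A(0)=0$). *)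

(* Defs.v *)
From mathcomp Require Import all_boot.

Set Implicit Arguments.
Unset Strict Implicit.
Unset Printing Implicit Defensive.

(* In this file a : nat -> nat is meant to be strictly increasing with
   a 0 = 1, so that i < a i for all i.  Hence an index i with a i <= m
   satisfies i < m, which justifies the search and summation bounds below. *)

(* The index i with a i <= m < a i.+1, for 1 <= m. *)
Definition greedy_index (a : nat -> nat) (m : nat) : nat :=
  find (fun i => a i <= m < a i.+1) (iota 0 m).

(* Every step decreases the remainder by at least 1, so fuel m suffices to
   reach the remainder 0 from m. *)
Fixpoint greedy_rec (a : nat -> nat) (fuel m : nat) : seq nat :=
  if fuel is fuel'.+1 then
    if m == 0 then [::]
    else let i := greedy_index a m in i :: greedy_rec a fuel' (m - a i)
  else [::].

(* The indices selected by the greedy algorithm on m, in order. *)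
Definition greedy (a : nat -> nat) (m : nat) : seq nat := greedy_rec a m m.

Definition digit (a : nat -> nat) (m i : nat) : nat := count_mem i (greedy a m).

(* The digits of m of index at least m vanish, so this is the sum of all
   digits. *)
Definition sum_digits (a : nat -> nat) (m : nat) : nat :=
  \sum_(0 <= i < m) digit a m i.

Definition cumul_sum_digits (a : nat -> nat) (m : nat) : nat :=
  \sum_(0 <= j < m) sum_digits a j.

(* Main.v *)
Require Import Defs.
From mathcomp Require Import all_boot all_order all_algebra.
From mathcomp Require Import zify.

(** Put p = q - 1 and F n = G (n + p).  Then F (n + 1) = F n + F (n - p) for
    n >= p, and F n = a (n - p), so each j in [F n, F (n + 1)) has first greedy
    summand F n and s_A j = 1 + s_A (j - F n); hence S_A (F (n + 1)) =
    S_A (F n) + F (n - p) + S_A (F (n - p)).  By Pascal's rule the binomial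
    sums on the right-hand sides satisfy the same recurrences. *)

Lemma leq_strict_mono {a : nat -> nat} :
  (forall i, a i < a i.+1) -> {mono a : i j / i <= j}.
Proof.
by move=> a_lt; apply: leq_mono; apply: homo_ltn => //; apply: ltn_trans.
Qed.

Lemma ltn_strict_mono {a : nat -> nat} :
  a 0 = 1 -> (forall i, a i < a i.+1) -> forall i, i < a i.
Proof.
move=> a0 a_lt; elim=> [|i IHi]; first by rewrite a0.
exact: leq_ltn_trans IHi (a_lt i).
Qed.

(** Since [i < a i <= m], the index lies in the searched range [iota 0 m]; the intervals
    [[a i, a i.+1)] are disjoint, so whatever [find] returns must be [i]. *)
Lemma greedy_index_eq {a : nat -> nat} {m i : nat} :
  a 0 = 1 -> (forall i, a i < a i.+1) -> a i <= m < a i.+1 ->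
  greedy_index a m = i.
Proof.
move=> a0 a_lt a_im; have amono := leq_strict_mono a_lt.
have lt_im : i < m.
  case/andP: a_im => le_aim _.
  exact: leq_trans (ltn_strict_mono a0 a_lt i) le_aim.
have a_has : has (fun i => a i <= m < a i.+1) (iota 0 m).
  by apply/hasP; exists i; rewrite ?mem_iota.
have := nth_find 0 a_has; rewrite -/(greedy_index a m).
have := a_has; rewrite has_find size_iota -/(greedy_index a m) => lt_km.
rewrite nth_iota // add0n; set k := greedy_index a m.
case/andP: a_im => le_aim lt_mai /andP[le_akm lt_mak].
have: i < k.+1 by rewrite -(leqW_mono amono); apply: leq_ltn_trans lt_mak.
have: k < i.+1 by rewrite -(leqW_mono amono); apply: leq_ltn_trans lt_mai.
by rewrite !ltnS => le_ki le_ik; apply/eqP; rewrite eqn_leq le_ki.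
Qed.

Lemma greedy_index_exists {a : nat -> nat} {m : nat} :
  a 0 = 1 -> (forall i, a i < a i.+1) -> 0 < m ->
  exists i, a i <= m < a i.+1.
Proof.
move=> a0 a_lt; elim: m => // -[_ _|m /(_ isT)[i /andP[le_aim lt_mai]] _].
  by exists 0; rewrite a0 leqnn -{1}a0 a_lt.
have [lt_m1|le_m1] := ltnP m.+2 (a i.+1).
  by exists i; rewrite lt_m1 (leq_trans le_aim).
by exists i.+1; rewrite le_m1 (leq_ltn_trans lt_mai).
Qed.

(** Needed to unfold [greedy]: one step on [m] leaves fuel [m.-1], whereas [greedy a (m - a i)]
    starts with fuel [m - a i]. *)
Lemma greedy_rec_fuel {a : nat -> nat} {f g m : nat} :
  (forall i, 0 < a i) -> m <= f -> m <= g ->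
  greedy_rec a f m = greedy_rec a g m.
Proof.
move=> a_gt0; elim: f g m => [|f IHf] [|g] m /=.
- by [].
- by rewrite leqn0 => ->.
- by rewrite leqn0 => _ ->.
case: eqP => // m_neq0 lt_mf lt_mg; congr (_ :: _).
by apply: IHf; have := a_gt0 (greedy_index a m); lia.
Qed.

Lemma greedy_cons {a : nat -> nat} {m i : nat} :
  a 0 = 1 -> (forall i, a i < a i.+1) -> a i <= m < a i.+1 ->
  greedy a m = i :: greedy a (m - a i).
Proof.
move=> a0 a_lt a_im; have i_lt := ltn_strict_mono a0 a_lt.
have a_gt0 j : 0 < a j by apply: leq_ltn_trans (i_lt j).
case: m a_im => [|m] a_im; first by have := i_lt i; lia.
rewrite {1}/greedy /= (greedy_index_eq a0 a_lt a_im); congr (_ :: _).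
by apply: greedy_rec_fuel => //; have := a_gt0 i; lia.
Qed.

(** Ensures that the cutoff at [m] in [sum_digits] loses no digit. *)
Lemma greedy_ltn {a : nat -> nat} {m : nat} :
  a 0 = 1 -> (forall i, a i < a i.+1) -> all (fun i => i < m) (greedy a m).
Proof.
move=> a0 a_lt; have i_lt := ltn_strict_mono a0 a_lt.
elim/ltn_ind: m => -[//|m] IHm.
have [//|i a_im] := greedy_index_exists (m := m.+1) a0 a_lt.
rewrite (greedy_cons a0 a_lt a_im) /=; have lt_i := i_lt i.
apply/andP; split; first by lia.
apply: sub_all (IHm (m.+1 - a i) _); last by lia.
by move=> j /=; lia.
Qed.

Lemma sum_digitsE {a : nat -> nat} {m : nat} :
  a 0 = 1 -> (forall i, a i < a i.+1) -> sum_digits a m = size (greedy a m).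
Proof.
move=> a0 a_lt; rewrite /sum_digits /digit.
elim: (greedy a m) (greedy_ltn (m := m) a0 a_lt) => [|i s IHs] /=.
  by rewrite big1_eq.
case/andP=> lt_im /IHs {}IHs; rewrite big_split /= IHs -add1n; congr (_ + _).
rewrite big_mkord (bigD1 (Ordinal lt_im)) //= eqxx big1 // => j.
by rewrite eq_sym -val_eqE /= => /negbTE->.
Qed.

Lemma cumul_sum_digits_next {a : nat -> nat} {i : nat} :
  a 0 = 1 -> (forall i, a i < a i.+1) ->
  cumul_sum_digits a (a i.+1) =
    cumul_sum_digits a (a i) + (a i.+1 - a i)
    + cumul_sum_digits a (a i.+1 - a i).
Proof.
move=> a0 a_lt; rewrite /cumul_sum_digits.
rewrite (big_cat_nat (n := a i)) //= ?(ltnW (a_lt i)) // -addnA; congr (_ + _).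
set d := a i.+1 - a i.
suff -> : \sum_(a i <= j < a i.+1) sum_digits a j =
          \sum_(0 <= j < d) (1 + sum_digits a j).
  by rewrite big_split sum_nat_const_nat subn0 muln1.
rewrite -{1}[a i]add0n big_addn -/d.
apply: eq_big_nat => j /andP[_ lt_jd]; rewrite !sum_digitsE //.
by rewrite (@greedy_cons a (j + a i) i) ?addnK //; rewrite /d in lt_jd; lia.
Qed.

(** Common form of both binomial sums, with [p = q - 1]: the constant weight 1 gives [G], the weight
    [id] gives the cumulative digit sum. *)
Definition diag_sum (p : nat) (w : nat -> nat) (n : nat) : nat :=
  \sum_(0 <= k < (n %/ p.+1).+1) w k * 'C(n - k * p, k).

(** Once [k * p.+1 > n], the truncated difference [n - k * p] is below [k], so the extra binomials
    vanish. *)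
Lemma diag_sum_widen {p : nat} {w : nat -> nat} {n N : nat} :
  n %/ p.+1 < N -> diag_sum p w n = \sum_(0 <= k < N) w k * 'C(n - k * p, k).
Proof.
move=> lt_nN; rewrite [RHS](big_cat_nat (n := (n %/ p.+1).+1)) //=.
rewrite [X in _ = _ + X]big_nat_cond [X in _ = _ + X]big1 ?addn0 //.
move=> k /andP[/andP[lt_nk _] _].
by rewrite bin_small ?muln0 //; move: lt_nk; rewrite ltn_divLR // mulnS; lia.
Qed.

Lemma diag_sum_small {p : nat} {w : nat -> nat} {n : nat} :
  n <= p -> diag_sum p w n = w 0.
Proof.
by move=> le_np; rewrite /diag_sum divn_small // big_nat1 bin0 muln1.
Qed.

Lemma diag_sumS {p : nat} {w : nat -> nat} {n : nat} :
  p <= n ->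
  diag_sum p w n.+1 = diag_sum p w n + diag_sum p (w \o succn) (n - p).
Proof.
move=> le_pn.
have div_lt m N : m < N -> m %/ p.+1 < N by apply: leq_ltn_trans (leq_div _ _).
(* One term fewer here: the other two sums get [n.+2] terms and lose [k = 0], so all three then
   share one range and Pascal's rule applies termwise. *)
rewrite [diag_sum p _ (n - p)](@diag_sum_widen p _ _ n.+1);
  last by rewrite div_lt // ltnS leq_subr.
rewrite !(@diag_sum_widen p _ _ n.+2) ?div_lt //.
rewrite ![\sum_(0 <= k < n.+2) _]big_nat_recl // !bin0 -addnA; congr (_ + _).
rewrite -big_split; apply: eq_bigr => k _ /=; rewrite -mulnDr; congr (_ * _).
have -> : n - k.+1 * p = n - p - k * p by rewrite mulSn subnDA.
(* Pascal's rule needs an untruncated difference. Otherwise all upper indices are 0 and the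
   binomials vanish, as [p <= n] excludes [k = 0]. *)
have [le_kp|lt_kp] := leqP (k.+1 * p) n.
  by rewrite mulSn -binS; congr 'C(_, _); move: le_kp; rewrite mulSn; lia.
case: k lt_kp => [|k]; first by rewrite mul1n ltnNge le_pn.
by rewrite !mulSn => lt_nk; rewrite !bin_small //; lia.
Qed.

Theorem theorem4 (q : nat) (hq : 1 <= q) (G : nat -> nat)
  (G_init0 : forall k : nat, k + 2 <= q -> G k = 0)
  (G_init1 : G (q - 1) = 1)
  (G_rec : forall k : nat, G (k + q) = G (k + q - 1) + G k)
  (a : nat -> nat) (a_def : forall k : nat, a k = G (k + 2 * q - 2)) :
  forall n : nat,
    [/\ ((G (n + q)%N)%:Z - 1 = \sum_(0 <= k < n.+1) (G k)%:Z)%R,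
        G (n + q - 1) =
          \sum_(0 <= k < (n %/ q).+1) 'C(n - k * (q - 1), k)
      & cumul_sum_digits a (G (n + q - 1)) =
          \sum_(0 <= k < (n %/ q).+1) k * 'C(n - k * (q - 1), k)].
Proof.
case: q hq G_init0 G_init1 G_rec a_def => // p _ G0.
rewrite subn1 /= => Gp Grec.
move=> a_def n; rewrite addnS !subn1 /=.
have GS m : G (m.+1 + p) = G (m + p) + G m.
  by have := Grec m; rewrite addnS subn1 /= addSn.
have G_gt0 m : 0 < G (m + p).
  by elim: m => [|m IHm]; rewrite ?Gp // GS addn_gt0 IHm.
have aE k : a k = G (k + p + p) by rewrite a_def; congr G; lia.
(* [G] stays at 1 from index [p] to [2 * p]; [a] starts at the last of these, which makes it
   strictly increasing. *)
have G_init m : m <= p -> G (m + p) = 1.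
  elim: m => [|m IHm] le_mp; first by rewrite Gp.
  by rewrite GS IHm ?(ltnW le_mp) // G0 // addn2.
have a0 : a 0 = 1 by rewrite aE add0n G_init.
have a_lt i : a i < a i.+1 by rewrite !aE addSn GS -addn1 leq_add2l G_gt0.
have sumG : G (n + p).+1 = (\sum_(0 <= k < n.+1) G k).+1.
  elim: n => [|n IHn]; first by rewrite big_nat1 -addSn GS add0n Gp add1n.
  by rewrite big_nat_recr //= -addSn GS addSn IHn addSn.
have [GE SE] : G (n + p) = diag_sum p (fun=> 1) n
    /\ cumul_sum_digits a (G (n + p)) = diag_sum p id n.
  elim/ltn_ind: n {sumG} => m IHm; have [le_mp|lt_pm] := leqP m p.
    rewrite G_init // !diag_sum_small //; split=> //.
    by rewrite /cumul_sum_digits big_nat1 /sum_digits big_geq.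
  case: m lt_pm IHm => // m le_pm IHm.
  have [GEm SEm] := IHm m (ltnSn m).
  have [GEp SEp] := IHm (m - p) (leq_subr p m).
  have GSm : G (m.+1 + p) = G (m + p) + G (m - p + p) by rewrite GS subnK.
  split; first by rewrite GSm GEm GEp diag_sumS.
  have aEm : a (m - p) = G (m + p) by rewrite aE subnK.
  have aESm : a (m - p).+1 = G (m.+1 + p) by rewrite aE addSn subnK.
  rewrite -aESm (cumul_sum_digits_next a0 a_lt) aESm aEm GSm addKn SEm SEp GEp.
  (* The shifted weight [k.+1 = 1 + k] splits into the weights of [G (m - p + p)] and of its
     cumulative digit sum. *)
  rewrite diag_sumS // -addnA; congr (_ + _); rewrite -big_split.
  by apply: eq_bigr => k _; rewrite /= -mulnDl add1n.
split.
- by rewrite sumG -addn1 PoszD GRing.addrK (big_morph _ PoszD (erefl _)).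
- by rewrite GE; apply: eq_bigr => k _; rewrite mul1n.
- by rewrite SE.
Qed.
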